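(* Let $S$ be a positive semifield. The category of $\delta$-algebras is isomorphic to the category of $(\Sigma,E)$-algebras.
   Context: $S$ positive: $a+b=0\Rightarrow a=b=0$; semifield: nonzero elements invertible. $\mathcal S$: monad on Set with $\mathcal SX$ the finitely supported $X\to S$, $\mathcal S(f)(\phi)(y)=\sum_{x\in f^{-1}\{y\}}\phi(x)$, unit Dirac functions, $\mu(\Psi)(x)=\sum_\phi\Psi(\phi)\phi(x)$; its algebras are exactly left $S$-semimodules. $\mathcal P$: powerset monad; its algebras are complete semilattices. For $\Phi\in\mathcal S\mathcal PX$, with $\ni_X=\{(A,x)\mid x\in A\}$: $\delta_X(\Phi)=\{\phi\in\mathcal SX\mid\exists\psi\in\mathcal S(\ni_X).\ \forall A.\ \Phi(A)=\sum_{x\in A}\psi(A,x),\ \forall x.\ \phi(x)=\sum_{A\ni x}\psi(A,x)\}$. A $\delta$-algebra is a set $X$ with an $\mathcal S$-algebra structure $a$ and a $\mathcal P$-algebra structure $b$ such that $a\circ\mathcal S(b)=b\circ\mathcal P(a)\circ\delta_X$; morphisms are functions that are both $\mathcal S$- and $\mathcal P$-algebra morphisms. A $(\Sigma,E)$-algebra is a set with arbitrary joins $\bigsqcup_{i\in I}$ forming a complete semilattice, and $+,0,\lambda\cdot$ ($\lambda\in S$) forming a left $S$-semimodule, such that $\lambda\cdot\bigsqcup_ix_i=\bigsqcup_i\lambda\cdot x_i$ for $\lambda\neq0$ and $\bigsqcup_ix_i+\bigsqcup_jy_j=\bigsqcup_{(i,j)}(x_i+y_j)$; morphisms preserve all these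 operations. *)

(* Defs.v *)
From HB Require Import structures.
From mathcomp Require Import all_boot all_order all_algebra.
From mathcomp Require Import finmap boolp classical_sets functions cardinality.
From mathcomp Require Import fsbigop.

Set Implicit Arguments.
Unset Strict Implicit.
Unset Printing Implicit Defensive.

Import GRing.Theory.

Local Open Scope classical_set_scope.
Local Open Scope ring_scope.

Record category := Category {
  obj :> Type;
  hom : obj -> obj -> Type;
  idm : forall X, hom X X;
  comp : forall X Y Z, hom Y Z -> hom X Y -> hom X Z;
  comp_idl : forall X Y (f : hom X Y), comp (idm Y) f = f;
  comp_idr : forall X Y (f : hom X Y), comp f (idm X) = f;
  comp_assoc : forall X Y Z W (h : hom Z W) (g : hom Y Z) (f : hom X Y),
    comp h (comp g f) = comp (comp h g) f }.

Arguments idm {c} X.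

Record functor (C D : category) := Functor {
  fobj :> C -> D;
  farr : forall X Y : C, hom X Y -> hom (fobj X) (fobj Y);
  farr_id : forall X : C, farr (idm X) = idm (fobj X);
  farr_comp : forall (X Y Z : C) (g : hom Y Z) (f : hom X Y),
    farr (comp g f) = comp (farr g) (farr f) }.

Definition idF (C : category) : functor C C :=
  @Functor C C (fun X => X) (fun X Y f => f)
    (fun X => erefl) (fun X Y Z g f => erefl).

Section CompF.
Variables (C D E : category) (G : functor D E) (F : functor C D).

Let compF_id (X : C) : farr G (farr F (idm X)) = idm (G (F X)).
Proof. by rewrite !farr_id. Qed.

Let compF_comp (X Y Z : C) (g : hom Y Z) (f : hom X Y) :
  farr G (farr F (comp g f)) = comp (farr G (farr F g)) (farr G (farr F f)).
Proof. by rewrite !farr_comp. Qed.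

Definition compF : functor C E :=
  @Functor C E (fun X => G (F X)) (fun X Y f => farr G (farr F f))
    compF_id compF_comp.

End CompF.

(* The equations are equalities of functors, hence in particular identities
   on objects; this is not mere equivalence of categories. *)
Definition isomorphic_categories (C D : category) : Prop :=
  exists (F : functor C D) (G : functor D C),
    compF G F = idF C /\ compF F G = idF D.

Record monad := Monad {
  mon :> Type -> Type;
  fmap : forall X Y, (X -> Y) -> mon X -> mon Y;
  munit : forall X, X -> mon X;
  mmul : forall X, mon (mon X) -> mon X;
  fmap_id : forall X (t : mon X), fmap id t = t;
  fmap_comp : forall X Y Z (g : Y -> Z) (f : X -> Y) (t : mon X),
    fmap (g \o f) t = fmap g (fmap f t);
  munit_nat : forall X Y (f : X -> Y) (x : X),
    fmap f (munit x) = munit (f x);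
  mmul_nat : forall X Y (f : X -> Y) (t : mon (mon X)),
    fmap f (mmul t) = mmul (fmap (fmap f) t);
  mmul_unitl : forall X (t : mon X), mmul (munit t) = t;
  mmul_unitr : forall X (t : mon X), mmul (fmap (@munit X) t) = t;
  mmul_assoc : forall X (t : mon (mon (mon X))),
    mmul (mmul t) = mmul (fmap (@mmul X) t) }.

Arguments fmap T {X Y} f t : rename.
Arguments munit T {X} x : rename.
Arguments mmul T {X} t : rename.

Definition is_algebra (T : monad) (X : Type) (a : T X -> X) : Prop :=
  (forall x, a (munit T x) = x) /\
  (forall t : T (T X), a (mmul T t) = a (fmap T a t)).

Definition is_algebra_morphism (T : monad) (X Y : Type)
    (a : T X -> X) (b : T Y -> Y) (f : X -> Y) : Prop :=
  forall t, f (a t) = b (fmap T f t).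

Section PowersetMonad.

Let pow_id X (A : set X) : id @` A = A.
Proof. exact: image_id. Qed.

Let pow_comp X Y Z (g : Y -> Z) (f : X -> Y) (A : set X) :
  (g \o f) @` A = g @` (f @` A).
Proof. by rewrite image_comp. Qed.

Let pow_unit_nat X Y (f : X -> Y) (x : X) : f @` [set x] = [set f x].
Proof. exact: image_set1. Qed.

Let pow_mul_nat X Y (f : X -> Y) (AA : set (set X)) :
  f @` (\bigcup_(A in AA) A) = \bigcup_(B in image AA (image^~ f)) B.
Proof. by rewrite bigcup_image image_bigcup. Qed.

Let pow_unitl X (A : set X) : \bigcup_(B in [set A]) B = A.
Proof. exact: bigcup_set1. Qed.

Let pow_unitr X (A : set X) :
  \bigcup_(B in (fun x => [set x]) @` A) B = A.
Proof. by rewrite bigcup_image bigcup_imset1 image_id. Qed.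

Let pow_assoc X (AAA : set (set (set X))) :
  \bigcup_(A in \bigcup_(AA in AAA) AA) A =
  \bigcup_(A in (fun AA : set (set X) => \bigcup_(A in AA) A) @` AAA) A.
Proof. by rewrite bigcup_image bigcup_bigcup. Qed.

Definition powersetM : monad :=
  @Monad set (fun X Y (f : X -> Y) (A : set X) => f @` A)
    (fun X x => [set x]) (fun X (AA : set (set X)) => \bigcup_(A in AA) A)
    pow_id pow_comp pow_unit_nat pow_mul_nat pow_unitl pow_unitr pow_assoc.

End PowersetMonad.

Section SemimoduleMonad.
Variable S : pzSemiRingType.

Record fsupp (X : Type) := FSupp {
  fsval :> X -> S;
  fsvalP : finite_set [set x | fsval x <> 0] }.

Lemma fsupp_eq X (phi psi : fsupp X) : (forall x, phi x = psi x) -> phi = psi.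
Proof.
case: phi psi => [f fP] [g gP] /= /funext fg.
by rewrite fg in fP *; congr FSupp; exact: Prop_irrelevance.
Qed.

(* Library sums over sets require a choice structure on the index type:
   [{classic X}] is [X] with the one given by the axiom of choice. *)
Definition fsum (X : Type) (A : set X) (f : X -> S) : S :=
  \sum_(x \in (A : set {classic X})) f x.

Lemma finite_enum X (A : set X) : finite_set A ->
  exists2 s : seq {classic X}, uniq s & forall x, A x -> x \in s.
Proof.
move=> fA; have /finite_fsetP[s As] := fA : finite_set (A : set {classic X}).
by exists s; [exact: fset_uniq | move=> x; rewrite As].
Qed.

Lemma fsumE X (A : set X) (f : X -> S) (s : seq {classic X}) : uniq s ->
  (forall x, A x -> f x <> 0 -> x \in s) ->
  fsum A f = \sum_(x <- s | x \in (A : set {classic X})) f x.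
Proof.
move=> us fs; rewrite [RHS]bigfs ?set_mem_set //= => x; rewrite inE => Ax.
by apply: contraNeq => /eqP; exact: fs.
Qed.

Lemma fsum_eq X (A : set X) (f g : X -> S) :
  (forall x, A x -> f x = g x) -> fsum A f = fsum A g.
Proof. by move=> fg; apply: eq_fsbigr => x; rewrite inE; exact: fg. Qed.

Lemma fsum0 X (A : set X) (f : X -> S) :
  (forall x, A x -> f x = 0) -> fsum A f = 0.
Proof. by move=> f0; rewrite /fsum fsbig1. Qed.

Lemma fsum_neq0 X (A : set X) (f : X -> S) :
  fsum A f <> 0 -> exists2 x, A x & f x <> 0.
Proof.
move=> nz; apply: contrapT => nex; apply: nz; apply: fsum0 => x Ax.
by apply: contrapT => fx; apply: nex; exists x.
Qed.

Lemma fsum_single X (A : set X) (f : X -> S) x0 :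
  A x0 -> (forall x, A x -> x <> x0 -> f x = 0) -> fsum A f = f x0.
Proof.
move=> Ax0 f0; rewrite (@fsumE _ _ _ (@cons {classic X} x0 nil)) //.
  by rewrite big_cons big_nil addr0 mem_set.
move=> x Ax fx; have [->|nx] := pselect (x = x0); first exact: (@mem_head {classic X}).
by case: fx; apply: f0.
Qed.

Lemma fs_map_fin X Y (f : X -> Y) (phi : fsupp X) :
  finite_set [set y | fsum (f @^-1` [set y]) phi <> 0].
Proof.
apply: sub_finite_set (finite_image f (fsvalP phi)) => y /fsum_neq0[x /= <- nz].
by exists x.
Qed.

Definition fs_map X Y (f : X -> Y) (phi : fsupp X) : fsupp Y :=
  FSupp (fs_map_fin f phi).

Lemma fs_dirac_fin X (x : X) :
  finite_set [set y | (if `[< y = x >] then 1 else 0 : S) <> 0].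
Proof.
by apply: sub_finite_set (finite_set1 x) => y /=; case: asboolP.
Qed.

Definition fs_dirac X (x : X) : fsupp X := FSupp (fs_dirac_fin x).

Lemma fs_mu_fin X (Psi : fsupp (fsupp X)) :
  finite_set [set x | fsum setT (fun phi => Psi phi * phi x) <> 0].
Proof.
have fin := bigcup_finite (fsvalP Psi) (fun phi _ => fsvalP phi).
apply: sub_finite_set fin => x /fsum_neq0[phi _ nz]; exists phi => /= e.
  by apply: nz; rewrite e mul0r.
by apply: nz; rewrite e mulr0.
Qed.

Definition fs_mu X (Psi : fsupp (fsupp X)) : fsupp X := FSupp (fs_mu_fin Psi).

Lemma fsum_push X Y (f : X -> Y) (phi : fsupp X) (B : set Y) (h : Y -> S) :
  fsum B (fun y => fs_map f phi y * h y) =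
  fsum (f @^-1` B) (fun x => phi x * h (f x)).
Proof.
have [s us sP] := finite_enum (fsvalP phi).
have [t ut tP] := finite_enum (finite_image f (fsvalP phi)).
rewrite (fsumE ut); last first.
  move=> y _ nz; apply: tP; have : fs_map f phi y <> 0.
    by move=> e; apply: nz; rewrite e mul0r.
  by move=> /fsum_neq0[x /= <- ?]; exists x.
rewrite (fsumE us); last first.
  by move=> x _ nz; apply: sP => /= e; apply: nz; rewrite e mul0r.
under eq_bigr => y _.
  rewrite /= (fsumE us); last by move=> x _; exact: sP.
  rewrite mulr_suml big_mkcond /=; over.
rewrite exchange_big /= [RHS]big_mkcond /=; apply: eq_bigr => x _.
have mE : (x \in (f @^-1` B : set {classic X})) =
          ((f x : {classic Y}) \in (B : set {classic Y})).
  by apply/idP/idP; rewrite !inE.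
have [phi0|phin0] := pselect (phi x = 0).
  by rewrite phi0 mul0r if_same big1 // => y _; case: ifP; rewrite ?mul0r.
rewrite mE big_mkcond /= (bigD1_seq (f x : {classic Y})) //=; last first.
  by apply: tP; exists x.
rewrite big1 ?addr0 => [|y nfx]; first by case: ifP => // _; rewrite mem_set.
case: ifP => // _; case: ifP => //; rewrite inE /= => e.
by rewrite -e eqxx in nfx.
Qed.

Lemma fsum_bind X Y (phi : fsupp X) (K : X -> fsupp Y) (B : set Y)
    (h : Y -> S) :
  fsum B (fun y => fsum setT (fun x => phi x * K x y) * h y) =
  fsum setT (fun x => phi x * fsum B (fun y => K x y * h y)).
Proof.
have [s us sP] := finite_enum (fsvalP phi).
have [t ut tP] := finite_enum
  (bigcup_finite (fsvalP phi) (fun x _ => fsvalP (K x))).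
rewrite (fsumE ut); last first.
  move=> y _ nz; apply: tP.
  have : fsum setT (fun x => phi x * K x y) <> 0.
    by move=> e; apply: nz; rewrite e mul0r.
  move=> /fsum_neq0[x _ nz']; exists x => /= e.
    by apply: nz'; rewrite e mul0r.
  by apply: nz'; rewrite e mulr0.
rewrite (fsumE us); last first.
  by move=> x _ nz; apply: sP => /= e; apply: nz; rewrite e mul0r.
under eq_bigr => y _.
  rewrite (fsumE us); last first.
    by move=> x _ nz; apply: sP => /= e; apply: nz; rewrite e mul0r.
  rewrite mulr_suml; over.
rewrite exchange_big /=; apply: eq_bigr => x _.
have [phi0|phin0] := pselect (phi x = 0).
  by rewrite phi0 mul0r big1 // => y _; rewrite !mul0r.
rewrite (fsumE ut); last first.
  move=> y _ nz; apply: tP; exists x => //= e.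
  by apply: nz; rewrite e mul0r.
by rewrite mulr_sumr; apply: eq_bigr => y _; rewrite mulrA.
Qed.

Lemma fsum_mulr1 X (A : set X) (f : X -> S) :
  fsum A f = fsum A (fun x => f x * 1).
Proof. by apply: fsum_eq => x _; rewrite mulr1. Qed.

Let fs_id X (phi : fsupp X) : fs_map id phi = phi.
Proof.
by apply: fsupp_eq => x /=; rewrite (@fsum_single _ _ _ x) // => y /= ->.
Qed.

Let fs_comp X Y Z (g : Y -> Z) (f : X -> Y) (phi : fsupp X) :
  fs_map (g \o f) phi = fs_map g (fs_map f phi).
Proof.
apply: fsupp_eq => z; rewrite [RHS]fsum_mulr1.
by rewrite (fsum_push f phi _ (fun=> 1)) -fsum_mulr1.
Qed.

Lemma fs_diracE X (x y : X) : fs_dirac x y = if `[< y = x >] then 1 else 0.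
Proof. by []. Qed.

Let fs_dirac_nat X Y (f : X -> Y) (x : X) :
  fs_map f (fs_dirac x) = fs_dirac (f x).
Proof.
apply: fsupp_eq => y; rewrite fs_diracE; case: asboolP => [->|ne].
  rewrite /= (@fsum_single _ _ _ x) //; first by rewrite asboolT.
  by move=> z _ nz; rewrite asboolF.
by apply: fsum0 => z /= fz; rewrite asboolF // => zx; apply: ne; rewrite -fz zx.
Qed.

Let fs_mu_nat X Y (f : X -> Y) (Psi : fsupp (fsupp X)) :
  fs_map f (fs_mu Psi) = fs_mu (fs_map (fs_map f) Psi).
Proof.
apply: fsupp_eq => y.
rewrite [RHS](fsum_push (fs_map f) Psi setT (fun phi : fsupp Y => phi y)).
rewrite preimage_setT [LHS]fsum_mulr1 (fsum_bind Psi id).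
by apply: fsum_eq => phi _; rewrite -fsum_mulr1.
Qed.

Let fs_unitl X (phi : fsupp X) : fs_mu (fs_dirac phi) = phi.
Proof.
apply: fsupp_eq => x; rewrite /= (@fsum_single _ _ _ phi) //.
  by rewrite asboolT // mul1r.
by move=> psi _ ne; rewrite asboolF // mul0r.
Qed.

Let fs_unitr X (phi : fsupp X) : fs_mu (fs_map (@fs_dirac X) phi) = phi.
Proof.
apply: fsupp_eq => x.
rewrite [LHS](fsum_push (@fs_dirac X) phi setT (fun psi : fsupp X => psi x)).
rewrite (@fsum_single _ _ _ x) //; first by rewrite fs_diracE asboolT // mulr1.
by move=> y _ ne; rewrite fs_diracE asboolF ?mulr0 // => e; apply: ne.
Qed.

Let fs_assoc X (PPsi : fsupp (fsupp (fsupp X))) :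
  fs_mu (fs_mu PPsi) = fs_mu (fs_map (@fs_mu X) PPsi).
Proof.
apply: fsupp_eq => x.
rewrite [RHS](fsum_push (@fs_mu X) PPsi setT (fun phi : fsupp X => phi x)).
exact: (fsum_bind PPsi id setT (fun phi : fsupp X => phi x)).
Qed.

Definition semimoduleM : monad :=
  @Monad fsupp fs_map fs_dirac fs_mu
    fs_id fs_comp fs_dirac_nat fs_mu_nat fs_unitl fs_unitr fs_assoc.

End SemimoduleMonad.

Definition ni (X : Type) : Type := {p : set X * X | p.1 p.2}.

(* Summing over the pairs of [ni X] with first component [A] is summing over
   [x \in A], and dually for the second component. *)
Definition delta (S : pzSemiRingType) (X : Type) (Phi : fsupp S (set X)) :
    set (fsupp S X) :=
  [set phi | exists psi : fsupp S (ni X),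
    (forall A, Phi A = fsum [set p : ni X | (sval p).1 = A] psi) /\
    (forall x, phi x = fsum [set p : ni X | (sval p).2 = x] psi)].

Section DeltaAlgebras.
Variable S : pzSemiRingType.
Let SM := semimoduleM S.
Let PM := powersetM.

Record delta_algebra := DeltaAlgebra {
  dcar :> Type;
  dS : SM dcar -> dcar;
  dP : PM dcar -> dcar;
  dS_algebra : is_algebra dS;
  dP_algebra : is_algebra dP;
  dS_dP : forall Phi : SM (PM dcar),
    dS (fmap SM dP Phi) = dP (fmap PM dS (delta Phi)) }.

Definition is_delta_morphism (X Y : delta_algebra) (f : X -> Y) : Prop :=
  is_algebra_morphism (@dS X) (@dS Y) f /\
  is_algebra_morphism (@dP X) (@dP Y) f.

Definition delta_hom (X Y : delta_algebra) : Type :=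
  {f : X -> Y | is_delta_morphism f}.

Let delta_id_subproof (X : delta_algebra) : is_delta_morphism (@id X).
Proof. by split=> t; rewrite fmap_id. Qed.

Let delta_comp_subproof (X Y Z : delta_algebra)
    (g : delta_hom Y Z) (f : delta_hom X Y) :
  is_delta_morphism (sval g \o sval f).
Proof.
case: g f => [g [gS gP]] [f [fS fP]] /=.
by split=> t; rewrite fmap_comp /= (fS, fP) (gS, gP).
Qed.

Definition delta_idm (X : delta_algebra) : delta_hom X X :=
  exist _ id (delta_id_subproof X).

Definition delta_compm (X Y Z : delta_algebra)
    (g : delta_hom Y Z) (f : delta_hom X Y) : delta_hom X Z :=
  exist _ (sval g \o sval f) (delta_comp_subproof g f).

Lemma delta_hom_eq (X Y : delta_algebra) (f g : delta_hom X Y) :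
  sval f = sval g -> f = g.
Proof. by case: f g => [f fP] [g gP] /= fg; apply: eq_exist. Qed.

Definition delta_category : category.
Proof.
by refine (@Category delta_algebra delta_hom delta_idm delta_compm _ _ _) => *;
  apply: delta_hom_eq.
Defined.

End DeltaAlgebras.

(* [join] computes the least upper bounds of all small families for some
   (necessarily unique) partial order. *)
Definition is_complete_semilattice (X : Type)
    (join : forall I : Type, (I -> X) -> X) : Prop :=
  exists le : X -> X -> Prop,
    [/\ forall x, le x x,
        forall x y, le x y -> le y x -> x = y,
        forall x y z, le x y -> le y z -> le x z,
        forall I (x : I -> X) i, le (x i) (join I x) &
        forall I (x : I -> X) y, (forall i, le (x i) y) -> le (join I x) y].

(* The axioms of the library's [lSemiModType S], restated on a bare carrier
   because that structure also packs a choice operator, which would be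
   additional data on the objects of the category. *)
Record is_left_semimodule (S : pzSemiRingType) (X : Type)
    (add : X -> X -> X) (zero : X) (scale : S -> X -> X) : Prop := {
  sm_addA : associative add;
  sm_addC : commutative add;
  sm_add0 : left_id zero add;
  sm_scaleA : forall l m x, scale (l * m) x = scale l (scale m x);
  sm_scale1 : forall x, scale 1 x = x;
  sm_scaleDr : forall l x y, scale l (add x y) = add (scale l x) (scale l y);
  sm_scaleDl : forall l m x, scale (l + m) x = add (scale l x) (scale m x);
  sm_scale0l : forall x, scale 0 x = zero;
  sm_scale0r : forall l, scale l zero = zero }.

Section SigmaEAlgebras.
Variable S : pzSemiRingType.

Record sigmaE_algebra := SigmaEAlgebra {
  ecar :> Type;
  ejoin : forall I : Type, (I -> ecar) -> ecar;
  eadd : ecar -> ecar -> ecar;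
  ezero : ecar;
  escale : S -> ecar -> ecar;
  ejoin_complete : is_complete_semilattice ejoin;
  e_semimodule : is_left_semimodule eadd ezero escale;
  escale_join : forall (l : S) (I : Type) (x : I -> ecar), l <> 0 ->
    escale l (ejoin x) = ejoin (fun i => escale l (x i));
  eadd_join : forall (I J : Type) (x : I -> ecar) (y : J -> ecar),
    eadd (ejoin x) (ejoin y) = ejoin (fun p : I * J => eadd (x p.1) (y p.2)) }.

Definition is_sigmaE_morphism (X Y : sigmaE_algebra) (f : X -> Y) : Prop :=
  [/\ forall (I : Type) (x : I -> X), f (ejoin x) = ejoin (fun i => f (x i)),
      forall x y : X, f (eadd x y) = eadd (f x) (f y),
      f (ezero X) = ezero Y &
      forall (l : S) (x : X), f (escale l x) = escale l (f x)].

Definition sigmaE_hom (X Y : sigmaE_algebra) : Type :=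
  {f : X -> Y | is_sigmaE_morphism f}.

Let sigmaE_id_subproof (X : sigmaE_algebra) : is_sigmaE_morphism (@id X).
Proof. by []. Qed.

Let sigmaE_comp_subproof (X Y Z : sigmaE_algebra)
    (g : sigmaE_hom Y Z) (f : sigmaE_hom X Y) :
  is_sigmaE_morphism (sval g \o sval f).
Proof.
case: g f => [g [gJ gA g0 gS]] [f [fJ fA f0 fS]] /=; split=> /=.
- by move=> I x; rewrite fJ gJ.
- by move=> x y; rewrite fA gA.
- by rewrite f0 g0.
- by move=> l x; rewrite fS gS.
Qed.

Definition sigmaE_idm (X : sigmaE_algebra) : sigmaE_hom X X :=
  exist _ id (sigmaE_id_subproof X).

Definition sigmaE_compm (X Y Z : sigmaE_algebra)
    (g : sigmaE_hom Y Z) (f : sigmaE_hom X Y) : sigmaE_hom X Z :=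
  exist _ (sval g \o sval f) (sigmaE_comp_subproof g f).

Lemma sigmaE_hom_eq (X Y : sigmaE_algebra) (f g : sigmaE_hom X Y) :
  sval f = sval g -> f = g.
Proof. by case: f g => [f fP] [g gP] /= fg; apply: eq_exist. Qed.

Definition sigmaE_category : category.
Proof.
by refine (@Category sigmaE_algebra sigmaE_hom sigmaE_idm sigmaE_compm _ _ _)
  => *; apply: sigmaE_hom_eq.
Defined.

End SigmaEAlgebras.

Definition positive_semiring (S : pzSemiRingType) : Prop :=
  forall a b : S, a + b = 0 -> a = 0 /\ b = 0.

(* Multiplication is not assumed commutative, nor 1 different from 0. *)
Definition semifield (S : pzSemiRingType) : Prop :=
  forall a : S, a <> 0 -> exists b : S, a * b = 1 /\ b * a = 1.

(* Main.v *)
(* Only the comparison of the two families of axioms is not formal.  If the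
   operations of a delta-algebra are written additively, its law says that
   [\sum_A Phi A *: sup A] is the join of the elements [\sum_p psi p *: x_p]
   over the couplings [psi], carried by the pairs [p = (A_p, x_p)] with [x_p] in
   [A_p], of first marginal [Phi].

   From [delta] to [(Sigma, E)].  Couplings that are sums of Dirac functions
   show that addition and scaling are monotone; scaling by [l <> 0] therefore
   has the monotone inverse [l^-1] and preserves joins.  For [sup A + z] with
   [A <> [set z]], positivity forces a coupling over [dirac A + dirac {z}] to be
   carried by [A] and [{z}], each with mass 1, so its value is a convex
   combination of the [x + z], [x] in [A]; and the law at a single Dirac
   function puts convex combinations of elements of a set below its join.

   From [(Sigma, E)] to [delta].  Distributivity turns [\sum_A Phi A *: sup A]
   into the join of [\sum_A Phi A *: x_A] over all choices of [x_A] in [A], each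
   of which comes from a coupling; conversely [x_p] lies below [sup A_p], so
   by monotonicity the value of every coupling lies below the left-hand side. *)
From HB Require Import structures.
From mathcomp Require Import all_boot all_algebra.
From mathcomp Require Import boolp classical_sets functions cardinality.
From mathcomp Require Import fsbigop.
From Stdlib Require Import JMeq.
Require Import Defs.

Set Implicit Arguments.
Unset Strict Implicit.
Unset Printing Implicit Defensive.

Import GRing.Theory.

Local Open Scope classical_set_scope.
Local Open Scope ring_scope.

(** * Finitely supported functions as a semimodule *)

Section FreeSemimodule.
Variable S : pzSemiRingType.

Lemma fsumD X (A : set X) (f g : X -> S) :
  finite_set [set x | f x <> 0] -> finite_set [set x | g x <> 0] ->
  fsum A (fun x => f x + g x) = fsum A f + fsum A g.
Proof.
move=> ff fg; have /finite_enum[s us sP] : finite_set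
  ([set x | f x <> 0] `|` [set x | g x <> 0]) by rewrite finite_setU.
rewrite !(fsumE us) ?big_split // => x _ nz; apply: sP; [by right|by left|].
have [f0|] := pselect (f x = 0); last by left.
by right => /= g0; apply: nz; rewrite f0 g0 addr0.
Qed.

Lemma fsumZ X (A : set X) (l : S) (f : X -> S) :
  finite_set [set x | f x <> 0] ->
  fsum A (fun x => l * f x) = l * fsum A f.
Proof.
move=> /finite_enum[s us sP].
rewrite !(fsumE us) ?mulr_sumr // => x _ nz; apply: sP => // f0.
by apply: nz; rewrite f0 mulr0.
Qed.

Section Operations.
Variable X : Type.
Implicit Types phi psi : fsupp S X.

Fact fs_zero_fin : finite_set [set x : X | (fun=> 0 : S) x <> 0].
Proof. exact: sub_finite_set (finite_set0 X). Qed.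

Definition fs_zero : fsupp S X := FSupp fs_zero_fin.

Fact fs_add_fin phi psi : finite_set [set x | phi x + psi x <> 0].
Proof.
have fin : finite_set ([set x | phi x <> 0] `|` [set x | psi x <> 0]).
  by rewrite finite_setU; split; exact: fsvalP.
apply: sub_finite_set fin => x /= nz.
have [f0|] := pselect (phi x = 0); last by left.
by right => g0; apply: nz; rewrite f0 g0 addr0.
Qed.

Definition fs_add phi psi : fsupp S X := FSupp (fs_add_fin phi psi).

Fact fs_scale_fin (l : S) phi : finite_set [set x | l * phi x <> 0].
Proof.
by apply: sub_finite_set (fsvalP phi) => x /= nz e; apply: nz; rewrite e mulr0.
Qed.

Definition fs_scale (l : S) phi : fsupp S X := FSupp (fs_scale_fin l phi).

HB.instance Definition _ := gen_eqMixin (fsupp S X).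
HB.instance Definition _ := gen_choiceMixin (fsupp S X).

Fact fs_addA : associative fs_add.
Proof. by move=> *; apply: fsupp_eq => x /=; rewrite addrA. Qed.
Fact fs_addC : commutative fs_add.
Proof. by move=> *; apply: fsupp_eq => x /=; rewrite addrC. Qed.
Fact fs_add0 : left_id fs_zero fs_add.
Proof. by move=> *; apply: fsupp_eq => x /=; rewrite add0r. Qed.

HB.instance Definition _ :=
  GRing.isNmodule.Build (fsupp S X) fs_addA fs_addC fs_add0.

Fact fs_scaleA a b phi : fs_scale a (fs_scale b phi) = fs_scale (a * b) phi.
Proof. by apply: fsupp_eq => x /=; rewrite mulrA. Qed.
Fact fs_scale0 phi : fs_scale 0 phi = 0.
Proof. by apply: fsupp_eq => x /=; rewrite mul0r. Qed.
Fact fs_scale1 : left_id 1 fs_scale.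
Proof. by move=> *; apply: fsupp_eq => x /=; rewrite mul1r. Qed.
Fact fs_scaleDr : right_distributive fs_scale +%R.
Proof. by move=> *; apply: fsupp_eq => x /=; rewrite mulrDr. Qed.
Fact fs_scaleDl phi : {morph fs_scale^~ phi : a b / a + b}.
Proof. by move=> *; apply: fsupp_eq => x /=; rewrite mulrDl. Qed.

HB.instance Definition _ := GRing.Nmodule_isLSemiModule.Build S (fsupp S X)
  fs_scaleA fs_scale0 fs_scale1 fs_scaleDr fs_scaleDl.

Lemma fs_addE phi psi x : (phi + psi) x = phi x + psi x. Proof. by []. Qed.
Lemma fs_scaleE l phi x : (l *: phi) x = l * phi x. Proof. by []. Qed.

Lemma fs_sumE (I : Type) (r : seq I) (P : pred I) (F : I -> fsupp S X) x :
  (\sum_(i <- r | P i) F i) x = \sum_(i <- r | P i) F i x.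
Proof. by apply: (big_morph (fun phi : fsupp S X => phi x)). Qed.

Lemma fs_decomp phi (s : seq {classic X}) : uniq s ->
  (forall x, phi x <> 0 -> x \in s) ->
  phi = \sum_(x <- s) phi x *: fs_dirac S x.
Proof.
move=> us sP; apply: fsupp_eq => x; rewrite fs_sumE.
under eq_bigr => y _ do rewrite fs_scaleE fs_diracE.
have [phi0|/sP xs] := pselect (phi x = 0).
  rewrite big1 // => y _; case: asboolP => [<-|]; last by rewrite mulr0.
  by rewrite phi0 mul0r.
rewrite (bigD1_seq (x : {classic X})) //= asboolT // mulr1 big1 ?addr0 // => y.
by move=> /eqP ne; rewrite asboolF ?mulr0 // => e; apply: ne.
Qed.

End Operations.

(** By [fs_decomp] the Dirac functions span, so identities between semilinear maps only need
    checking there. *)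
Lemma semilinear_ext X (M : lSemiModType S) (f g : fsupp S X -> M) :
  semilinear f -> semilinear g ->
  (forall x, f (fs_dirac S x) = g (fs_dirac S x)) -> f =1 g.
Proof.
move=> [fZ fD] [gZ gD] fg phi.
have [s us sP] := finite_enum (fsvalP phi).
rewrite (fs_decomp us sP).
elim: s {us sP} => [|x s IHs]; last by rewrite !big_cons fD gD fZ gZ fg IHs.
by rewrite !big_nil -(scale0r 0) fZ gZ !scale0r.
Qed.

Lemma semilinear_sum X (M : lSemiModType S) (f : fsupp S X -> M) I (r : seq I)
    (P : pred I) (F : I -> fsupp S X) :
  semilinear f ->
  f (\sum_(i <- r | P i) F i) = \sum_(i <- r | P i) f (F i).
Proof.
by move=> [fZ fD]; apply: big_morph => //; rewrite -(scale0r 0) fZ scale0r.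
Qed.

Lemma fs_map_semilinear X Y (f : X -> Y) : semilinear (@fs_map S X Y f).
Proof.
split=> [l phi|phi psi]; apply: fsupp_eq => y /=.
  by rewrite fsumZ //; exact: fsvalP.
by rewrite fsumD //; exact: fsvalP.
Qed.

Lemma fs_mu_semilinear X : semilinear (@fs_mu S X).
Proof.
have fin (Phi : fsupp S (fsupp S X)) (x : X) :
    finite_set [set phi | Phi phi * (phi : fsupp S X) x <> 0].
  apply: sub_finite_set (fsvalP Phi) => phi /= nz e.
  by apply: nz; rewrite e mul0r.
split=> [l Phi|Phi Psi]; apply: fsupp_eq => x /=.
  by rewrite -fsumZ //; apply: fsum_eq => phi _; rewrite mulrA.
by rewrite -fsumD //; apply: fsum_eq => phi _; rewrite mulrDl.
Qed.

Lemma fs_map_dirac X Y (f : X -> Y) (x : X) :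
  fs_map f (fs_dirac S x) = fs_dirac S (f x).
Proof. exact: (munit_nat (semimoduleM S)). Qed.

Lemma fs_mu_dirac X (phi : fsupp S X) : fs_mu (fs_dirac S phi) = phi.
Proof. exact: (@mmul_unitl (semimoduleM S) X phi). Qed.

End FreeSemimodule.

(** * Semimodules as algebras *)

Section Semimodules.
Variable S : pzSemiRingType.

(** * Evaluation of linear combinations in a semimodule *)

Section LinearCombination.
Variables (X : Type) (add : X -> X -> X) (zero : X) (scale : S -> X -> X).

(** A copy of [X] tagged with the semimodule axioms, to which the library structures attach. Their
    equality test and choice operator come from classical axioms and add no data to an algebra. *)
Definition smod of is_left_semimodule add zero scale : Type := X.

Variable H : is_left_semimodule add zero scale.

HB.instance Definition _ := gen_eqMixin (smod H).
HB.instance Definition _ := gen_choiceMixin (smod H).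
HB.instance Definition _ := GRing.isNmodule.Build (smod H)
  (sm_addA H) (sm_addC H) (sm_add0 H).

Fact smod_scaleA a b (v : smod H) :
  scale a (scale b v) = scale (a * b) v :> smod H.
Proof. by rewrite (sm_scaleA H). Qed.

HB.instance Definition _ := GRing.Nmodule_isLSemiModule.Build S (smod H)
  smod_scaleA (sm_scale0l H) (sm_scale1 H) (sm_scaleDr H)
  (fun v a b => sm_scaleDl H a b v).

Definition lincomb (phi : fsupp S X) : smod H :=
  \sum_(x <- s2val (cid2 (finite_enum (fsvalP phi))))
    phi x *: (x : smod H).

(** Zero coefficients contribute nothing, so two enumerations covering the support become
    permutations of each other once filtered. The enumeration picked in [lincomb] is thus
    immaterial. *)
Lemma lincombE (phi : fsupp S X) (s : seq {classic X}) : uniq s ->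
  (forall x, phi x <> 0 -> x \in s) ->
  lincomb phi = \sum_(x <- s) phi x *: (x : smod H).
Proof.
rewrite /lincomb; case: cid2 => t /= ut tP us sP.
have rm (r : seq {classic X}) : \sum_(x <- r) phi x *: (x : smod H) =
    \sum_(x <- [seq x : {classic X} <- r | `[< phi x <> 0 >]])
      phi x *: (x : smod H).
  rewrite big_filter [RHS]big_mkcond; apply: eq_bigr => x _.
  by case: asboolP => // /contrapT ->; rewrite scale0r.
rewrite rm [RHS]rm; apply: perm_big; apply: uniq_perm; rewrite ?filter_uniq //.
move=> x; rewrite !mem_filter; case: asboolP => //= nz.
by rewrite sP // tP.
Qed.

Lemma lincomb_semilinear : semilinear (lincomb : fsupp S X -> smod H).
Proof.
split=> [l phi|phi psi].
  have [s us sP] := finite_enum (fsvalP phi).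
  rewrite !(lincombE us) ?scaler_sumr //; last first.
    by move=> x nz; apply: sP => e; apply: nz; rewrite fs_scaleE e mulr0.
  by apply: eq_bigr => x _; rewrite scalerA.
have /finite_enum[s us sP] : finite_set
    ([set x | phi x <> 0] `|` [set x | psi x <> 0]).
  by rewrite finite_setU; split; exact: fsvalP.
rewrite !(lincombE us); [|by move=> x nz; apply: sP; right
  |by move=> x nz; apply: sP; left|].
  by rewrite -big_split; apply: eq_bigr => x _; rewrite scalerDl.
move=> x nz; apply: sP; have [f0|] := pselect (phi x = 0); last by left.
by right => /= g0; apply: nz; rewrite fs_addE f0 g0 addr0.
Qed.

Lemma lincomb_dirac x : lincomb (fs_dirac S x) = x.
Proof.
rewrite (@lincombE _ (@cons {classic X} x nil)) //.
  by rewrite big_seq1 fs_diracE asboolT // scale1r.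
move=> y; rewrite fs_diracE; case: asboolP => // -> _.
exact: (@mem_head {classic X}).
Qed.

Lemma lincomb_uniq (f : fsupp S X -> smod H) : semilinear f ->
  (forall x, f (fs_dirac S x) = x) -> f =1 lincomb.
Proof.
move=> fL fd; apply: semilinear_ext => // [|x].
  exact: lincomb_semilinear.
by rewrite fd lincomb_dirac.
Qed.

Lemma lincomb_algebra : @is_algebra (semimoduleM S) X lincomb.
Proof.
split=> [x|]; first exact: lincomb_dirac.
have [lZ lD] := lincomb_semilinear.
have [mZ mD] := @fs_mu_semilinear S X.
have [pZ pD] := fs_map_semilinear S lincomb.
apply: (@semilinear_ext S _ (smod H) (lincomb \o @fs_mu S X)
  (lincomb \o fs_map lincomb)) => [||phi] /=.
- by split=> [l t|t u] /=; rewrite ?mZ ?mD ?lZ ?lD.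
- by split=> [l t|t u] /=; rewrite ?pZ ?pD ?lZ ?lD.
- by rewrite fs_mu_dirac fs_map_dirac lincomb_dirac.
Qed.

End LinearCombination.

Lemma lincomb_morph X (addX : X -> X -> X) zeroX scaleX Y (addY : Y -> Y -> Y)
    zeroY scaleY (HX : @is_left_semimodule S X addX zeroX scaleX)
    (HY : @is_left_semimodule S Y addY zeroY scaleY) (f : X -> Y) :
  (forall x y, f (addX x y) = addY (f x) (f y)) ->
  (forall l x, f (scaleX l x) = scaleY l (f x)) ->
  forall phi, f (lincomb HX phi) = lincomb HY (fs_map f phi).
Proof.
move=> fD fZ; have [lXZ lXD] := lincomb_semilinear HX.
have [lYZ lYD] := lincomb_semilinear HY.
have [pZ pD] := fs_map_semilinear S f.
apply: (@semilinear_ext S _ (smod HY) (f \o lincomb HX)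
  (lincomb HY \o fs_map f)) => [||x] /=.
- by split=> [l t|t u] /=; rewrite (lXZ, lXD) (fZ, fD).
- by split=> [l t|t u] /=; rewrite ?pZ ?pD ?lYZ ?lYD.
- by rewrite fs_map_dirac !lincomb_dirac.
Qed.

(** * The semimodule carried by an algebra *)

Section AlgebraSemimodule.
Variables (X : Type) (a : fsupp S X -> X).
Hypothesis aP : @is_algebra (semimoduleM S) X a.

Definition alg_add (x y : X) : X := a (fs_dirac S x + fs_dirac S y).
Definition alg_zero : X := a 0.
Definition alg_scale (l : S) (x : X) : X := a (l *: fs_dirac S x).

Lemma alg_dirac x : a (fs_dirac S x) = x.
Proof. by case: aP => + _; exact. Qed.

Lemma alg_mu Psi : a (fs_mu Psi) = a (fs_map a Psi).
Proof. by case: aP => _; exact. Qed.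

(** As [phi] is [fs_mu] of its Dirac function, [phi + psi] is [fs_mu] of a sum of two Dirac
    functions, and associativity evaluates the inner functions first. *)
Lemma alg_addE phi psi : a (phi + psi) = alg_add (a phi) (a psi).
Proof.
rewrite -[in LHS](fs_mu_dirac phi) -[in LHS](fs_mu_dirac psi).
rewrite -(fs_mu_semilinear S X).2 alg_mu.
by rewrite (fs_map_semilinear S a).2 !fs_map_dirac.
Qed.

Lemma alg_scaleE l phi : a (l *: phi) = alg_scale l (a phi).
Proof.
rewrite -[in LHS](fs_mu_dirac phi) -(fs_mu_semilinear S X).1 alg_mu.
by rewrite (fs_map_semilinear S a).1 fs_map_dirac.
Qed.

Lemma alg_semimodule : is_left_semimodule alg_add alg_zero alg_scale.
Proof.
split=> [x y z|x y|x|l m x|x|l x y|l m x|x|l].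
- by rewrite -(alg_dirac x) -(alg_dirac y) -(alg_dirac z) -!alg_addE addrA.
- by rewrite /alg_add addrC.
- by rewrite -(alg_dirac x) -alg_addE add0r.
- by rewrite -(alg_dirac x) -!alg_scaleE scalerA.
- by rewrite -{1}(alg_dirac x) -alg_scaleE scale1r alg_dirac.
- rewrite -(alg_dirac x) -(alg_dirac y).
  by rewrite -!(alg_addE, alg_scaleE) scalerDr.
- by rewrite -(alg_dirac x) -!(alg_scaleE, alg_addE) scalerDl.
- by rewrite /alg_scale scale0r.
- by rewrite -alg_scaleE scaler0.
Qed.

End AlgebraSemimodule.
End Semimodules.

(** * Complete semilattices as algebras *)

Section CompleteSemilattices.
Variable X : Type.

(** * The order determined by joins *)

Section Order.
Variable join : forall I : Type, (I -> X) -> X.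
Hypothesis joinP : is_complete_semilattice join.

(** Recovering the order from binary joins makes it depend on [join] alone, whereas
    [is_complete_semilattice] only asserts that some order exists. *)
Definition jle (x y : X) : Prop :=
  join (fun b : bool => if b then x else y) = y.

Lemma jle_spec : [/\ forall x, jle x x,
  forall x y, jle x y -> jle y x -> x = y,
  forall x y z, jle x y -> jle y z -> jle x z,
  forall I (x : I -> X) i, jle (x i) (join x) &
  forall I (x : I -> X) y, (forall i, jle (x i) y) -> jle (join x) y].
Proof.
case: joinP => le [lexx le_anti le_trans ub lub].
suff jleE : jle = le by rewrite jleE; split.
apply: funext => x; apply: funext => y; apply: propext; split=> [<-|xy].
  exact: (ub _ (fun b : bool => if b then x else y) true).
apply: le_anti; first by apply: lub; case.
exact: (ub _ (fun b : bool => if b then x else y) false).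
Qed.

Lemma jlexx x : jle x x. Proof. by case: jle_spec. Qed.

Lemma jle_anti x y : jle x y -> jle y x -> x = y.
Proof. by case: jle_spec => _ + _ _ _; exact. Qed.

Lemma jle_trans y x z : jle x y -> jle y z -> jle x z.
Proof. by case: jle_spec => _ _ + _ _; exact. Qed.

Lemma join_ub I (x : I -> X) i : jle (x i) (join x).
Proof. by case: jle_spec. Qed.

Lemma join_lub I (x : I -> X) y : (forall i, jle (x i) y) -> jle (join x) y.
Proof. by case: jle_spec => _ _ _ _; exact. Qed.

Lemma join_eq I J (x : I -> X) (y : J -> X) :
  (forall i, exists j, y j = x i) -> (forall j, exists i, x i = y j) ->
  join x = join y.
Proof.
move=> xy yx; apply: jle_anti; apply: join_lub.
  by move=> i; have [j <-] := xy i; exact: join_ub.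
by move=> j; have [i <-] := yx j; exact: join_ub.
Qed.

Lemma join_unit x : join (fun _ : unit => x) = x.
Proof.
apply: jle_anti; first by apply: join_lub => _; exact: jlexx.
exact: (join_ub (fun _ : unit => x) tt).
Qed.

Definition join_set (A : set X) : X := join (fun x : {x | A x} => sval x).

Lemma join_set_ub (A : set X) x : A x -> jle x (join_set A).
Proof. by move=> Ax; exact: (join_ub (fun x => sval x) (exist A x Ax)). Qed.

Lemma join_set_lub (A : set X) y :
  (forall x, A x -> jle x y) -> jle (join_set A) y.
Proof. by move=> Ay; apply: join_lub => -[x Ax]; exact: Ay. Qed.

Lemma join_set_range I (x : I -> X) : join_set (range x) = join x.
Proof.
apply: join_eq => [[y yr]|i]; first by have [i _ e] := yr; exists i.
by exists (exist _ (x i) (imageT x i)).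
Qed.

Lemma join_set_algebra : @is_algebra powersetM X join_set.
Proof.
split=> [x|AA].
  apply: jle_anti; first by apply: join_set_lub => _ ->; exact: jlexx.
  exact: join_set_ub.
apply: jle_anti; apply: join_set_lub.
  move=> x [A AA_A Ax]; apply: jle_trans (join_set_ub Ax) _.
  by apply: join_set_ub; exists A.
move=> _ [A AA_A <-]; apply: join_set_lub => x Ax.
by apply: join_set_ub; exists A.
Qed.

End Order.

(** * Joins of families from a powerset algebra *)

Section PowersetAlgebra.
Variable b : set X -> X.
Hypothesis bP : @is_algebra powersetM X b.

Definition alg_join (I : Type) (x : I -> X) : X := b (range x).

Lemma alg_set1 x : b [set x] = x.
Proof. by case: bP => + _; exact. Qed.

Lemma alg_bigcup (AA : set (set X)) : b (\bigcup_(A in AA) A) = b (b @` AA).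
Proof. by case: bP => _; exact. Qed.

Lemma alg_setU (A B : set X) : b (A `|` B) = b [set b A; b B].
Proof.
have -> : A `|` B = \bigcup_(C in [set A; B]) C.
  by rewrite bigcup_setU !bigcup_set1.
by rewrite alg_bigcup image_setU !image_set1.
Qed.

Lemma alg_join_complete : is_complete_semilattice alg_join.
Proof.
have b2 A y : b [set b A; y] = b (A `|` [set y]).
  by rewrite [RHS]alg_setU alg_set1.
exists (fun x y => b [set x; y] = y); split.
- by move=> x; rewrite setUid alg_set1.
- by move=> x y xy yx; rewrite -xy -[LHS]yx setUC.
- by move=> x y z xy yz; rewrite -yz setUC b2 setUC setUA -b2 xy.
- by move=> I x i; rewrite setUC b2 setUidl // => _ ->; exists i.
move=> I x y xy; rewrite b2.
(* Every member of this family is sent to [y] by [b]; the extra member [[set y]] keeps the family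
   nonempty when [I] is empty. *)
have -> : range x `|` [set y] =
    \bigcup_(A in (fun i => [set x i; y]) @` setT `|` [set [set y]]) A.
  rewrite bigcup_setU bigcup_set1 bigcup_image; apply/seteqP; split.
    by move=> z [[i _ <-]|zy]; [left; exists i => //; left|right].
  by move=> z [[i _ [->|zy]]|zy]; [left; exists i|right|right].
rewrite alg_bigcup -[RHS]alg_set1; congr b; apply/seteqP; split=> z.
  by move=> [_ [[i _ <-]|->] <-] /=; [exact: xy|exact: alg_set1].
by move=> ->; exists [set y]; [right|exact: alg_set1].
Qed.

Lemma alg_join_set : join_set alg_join = b.
Proof.
apply: funext => A; congr b; apply/seteqP; split=> [_ [[x Ax] _ <-] //|x Ax].
by exists (exist _ x Ax).
Qed.

End PowersetAlgebra.
End CompleteSemilattices.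

(** * From distributive laws to equations *)

Section DeltaToSigmaE.
Variable S : pzSemiRingType.

Definition ni_set X (p : ni X) : set X := (sval p).1.
Definition ni_elt X (p : ni X) : X := (sval p).2.
Definition ni_pair X (A : set X) x (Ax : A x) : ni X :=
  exist (fun p => p.1 p.2) (A, x) Ax.

(** The marginals of a coupling are its images under the two projections, which makes semilinearity
    of [fs_map] available. *)
Lemma deltaP X (Phi : fsupp S (set X)) phi : delta Phi phi <->
  exists2 psi, fs_map (@ni_set X) psi = Phi & fs_map (@ni_elt X) psi = phi.
Proof.
split=> [[psi [PhiE phiE]]|[psi <- <-]]; last by exists psi.
by exists psi; apply: fsupp_eq.
Qed.

Variable D : delta_algebra S.

Notation M := (smod (alg_semimodule (dS_algebra D))).
Notation djoin := (alg_join (@dP S D)).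
Notation dle := (jle djoin).

Let djoinP : is_complete_semilattice djoin.
Proof. exact: alg_join_complete (dP_algebra D). Qed.

Lemma dP_ub (A : set D) x : A x -> dle x (dP A).
Proof. by have := @join_set_ub _ _ djoinP A x; rewrite alg_join_set. Qed.

Lemma dP_lub (A : set D) y : (forall x, A x -> dle x y) -> dle (dP A) y.
Proof. by have := @join_set_lub _ _ djoinP A y; rewrite alg_join_set. Qed.

Lemma dS_semilinear : semilinear (@dS S D : fsupp S D -> M).
Proof.
have aP := dS_algebra D.
by split=> *; [exact: (alg_scaleE aP)|exact: (alg_addE aP)].
Qed.

Lemma dS_dirac x : dS (fs_dirac S x : semimoduleM S D) = x.
Proof. exact: alg_dirac (dS_algebra D) x. Qed.

Lemma dS_map_scale_dirac X (f : X -> D) l x :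
  dS (fs_map f (l *: fs_dirac S x) : semimoduleM S D) = l *: (f x : M) :> M.
Proof.
by rewrite (fs_map_semilinear S f).1 fs_map_dirac dS_semilinear.1 dS_dirac.
Qed.

(** The distributive law is read as a least upper bound over couplings: this is the upper bound
    half, [dS_dP_lub] the leastness half. *)
Lemma dS_dP_ub (psi : fsupp S (ni D)) :
  dle (dS (fs_map (@ni_elt D) psi : semimoduleM S D))
    (dS (fs_map (@dP S D) (fs_map (@ni_set D) psi) : semimoduleM S D)).
Proof.
rewrite (dS_dP (fs_map (@ni_set D) psi : semimoduleM S (powersetM D))).
apply: dP_ub; exists (fs_map (@ni_elt D) psi) => //.
by apply/deltaP; exists psi.
Qed.

Lemma dS_dP_lub (Phi : fsupp S (set D)) c :
  (forall psi : fsupp S (ni D), fs_map (@ni_set D) psi = Phi ->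
     dle (dS (fs_map (@ni_elt D) psi : semimoduleM S D)) c) ->
  dle (dS (fs_map (@dP S D) Phi : semimoduleM S D)) c.
Proof.
move=> ub; rewrite (dS_dP (Phi : semimoduleM S (powersetM D))).
by apply: dP_lub => _ [_ /deltaP[psi PhiE <-] <-]; exact: ub.
Qed.

Lemma dle_scale l (x y : M) : dle x y -> dle (l *: x : M) (l *: y : M).
Proof.
(* With [y] written as the join of [x] and [y], the law applies to a single pair: the set of these
   two and its element [x]. *)
move=> <-.
have Ax : range (fun b : bool => if b then x else y) x by exists true.
have := dS_dP_ub (l *: fs_dirac S (ni_pair Ax)).
by rewrite !(fs_map_semilinear S _).1 !fs_map_dirac !dS_semilinear.1 !dS_dirac.
Qed.

Lemma dle_add (x y x' y' : M) :
  dle x x' -> dle y y' -> dle (x + y : M) (x' + y' : M).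
Proof.
move=> <- <-.
have Ax : range (fun b : bool => if b then x else x') x by exists true.
have Ay : range (fun b : bool => if b then y else y') y by exists true.
have := dS_dP_ub (fs_dirac S (ni_pair Ax) + fs_dirac S (ni_pair Ay)).
by rewrite !(fs_map_semilinear S _).2 !fs_map_dirac !dS_semilinear.2 !dS_dirac.
Qed.

Lemma dscale_join l m I (x : I -> M) : l * m = 1 -> m * l = 1 ->
  l *: (djoin x : M) = djoin (fun i => l *: x i : M) :> M.
Proof.
move=> lm ml; apply: (jle_anti djoinP); last first.
  by apply: join_lub => // i; apply/dle_scale/join_ub.
(* Inserting [l * m = 1] on the right lets [l] cancel by monotonicity; each [x i] is then rewritten
   as [m *: (l *: x i)]. *)
rewrite -[djoin _ in X in jle _ _ X](scale1r (_ : M)) -lm -scalerA.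
apply: dle_scale; apply: join_lub => // i.
rewrite -[x i](scale1r (_ : M)) -ml -scalerA.
by apply: dle_scale; exact: (join_ub djoinP (fun i => l *: x i : M)).
Qed.

(* The set of lower bounds of [c] has join [c], so the distributive law sends
   the Dirac function at that set to an upper bound of its convex
   combinations. *)
Lemma dle_convex I (r : seq I) (P : pred I) (w : I -> S) (f : I -> M) (c : M) :
  \sum_(i <- r | P i) w i = 1 -> (forall i, P i -> dle (f i) c) ->
  dle (\sum_(i <- r | P i) w i *: f i) c.
Proof.
(* The default [c] outside [P] keeps every [g i] below [c], so that a pair of [ni D] exists for each
   index. *)
move=> w1 fc; pose g i := if P i then f i else c.
have gc i : dle (g i) c by rewrite /g; case: ifP => [/fc//|_]; exact: jlexx.
pose A : set D := [set x | dle x c].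
have dPA : dP (A : powersetM D) = c.
  by apply: (jle_anti djoinP); [exact: dP_lub|apply: dP_ub; exact: jlexx].
pose psi := \sum_(i <- r | P i) w i *: fs_dirac S (@ni_pair _ A _ (gc i)).
have := dS_dP_ub psi; rewrite !(semilinear_sum _ _ _ (fs_map_semilinear S _)).
rewrite !(semilinear_sum _ _ _ dS_semilinear).
under eq_bigr do rewrite dS_map_scale_dirac.
under [X in dle _ X]eq_bigr do
  rewrite (fs_map_semilinear S _).1 fs_map_dirac dS_map_scale_dirac dPA.
rewrite -scaler_suml w1 scale1r; congr (dle _ _).
by apply: eq_bigr => i Pi; rewrite /ni_elt /= /g Pi.
Qed.

Hypothesis S_positive : positive_semiring S.

Lemma dP_add_lub (A : set D) (z c : M) :
  (forall x : M, A x -> dle (x + z : M) c) -> dle ((dP A : M) + z : M) c.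
Proof.
have dP1 : dP ([set z] : powersetM D) = z by case: (dP_algebra D) => + _; exact.
(* When [A] is [[set z]] the two Dirac functions coincide and their masses cannot be told apart, but
   then the join of [A] is [z]. *)
move=> Ac; have [Az|nAz] := pselect (A = [set z]).
  by move: (Ac z); rewrite Az dP1; exact.
have := @dS_dP_lub (fs_dirac S A + fs_dirac S [set z]) c.
rewrite (fs_map_semilinear S _).2 !fs_map_dirac dS_semilinear.2 !dS_dirac dP1.
apply=> psi psiE; have [s us sP] := finite_enum (fsvalP psi).
have mass B : \sum_(p <- s | `[< ni_set p = B >]) psi p =
    (fs_dirac S A + fs_dirac S [set z]) B.
  rewrite -psiE /= (fsumE us); last by move=> p _; exact: sP.
  by apply: eq_bigl => p; apply/asboolP/idP; rewrite inE.
(* Over a set other than [A] and [[set z]] the masses sum to zero, so by positivity each of them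
   vanishes. *)
have supp p : psi p <> 0 -> ni_set p <> A -> ni_set p = [set z].
  move=> nz nA; apply: contrapT => nz1; apply: nz.
  have := mass (ni_set p); rewrite fs_addE !fs_diracE !asboolF // addr0.
  have [//|/sP ps] := pselect (psi p = 0).
  rewrite big_mkcond (bigD1_seq (p : {classic ni D})) //= asboolT //.
  by case/S_positive.
have massA : \sum_(p <- s | `[< ni_set p = A >]) psi p = 1.
  by rewrite mass fs_addE !fs_diracE asboolT // asboolF // addr0.
have massz : \sum_(p <- s | `[< ni_set p = [set z] >]) psi p = 1.
  rewrite mass fs_addE !fs_diracE asboolF ?asboolT ?add0r //.
  by move=> e; apply: nAz.
rewrite [in dS _](fs_decomp us sP).
rewrite (semilinear_sum _ _ _ (fs_map_semilinear S _)).
rewrite (semilinear_sum _ _ _ dS_semilinear).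
under eq_bigr do rewrite dS_map_scale_dirac.
rewrite (bigID (fun p => `[< ni_set p = A >])) /=.
have -> : \sum_(p <- s | ~~ `[< ni_set p = A >]) psi p *: (ni_elt p : M) = z.
  rewrite -[RHS]scale1r -massz scaler_suml big_mkcond [RHS]big_mkcond.
  apply: eq_bigr => p _.
  have [->|/supp pz] := pselect (psi p = 0); first by rewrite !scale0r !if_same.
  case: asboolP => [->|/pz pE]; first by rewrite asboolF.
  rewrite /= asboolT //; congr (_ *: _).
  by have : ni_set p (ni_elt p) := proj2_sig p; rewrite pE.
(* The coefficients over [A] also sum to 1, so [z] can be spread over those pairs, leaving a convex
   combination of elements [x + z]. *)
rewrite -[z]scale1r -massA scaler_suml -big_split /=.
under eq_bigr do rewrite -scalerDr.
apply: dle_convex => // p /asboolP pA; apply: Ac; rewrite -pA.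
exact: (proj2_sig p).
Qed.

(** Monotonicity puts the right side below the left. Conversely, [dP_add_lub] replaces one join at a
    time by its members, commutativity bringing the second join to the front. *)
Lemma dadd_join I J (x : I -> M) (y : J -> M) :
  (djoin x : M) + (djoin y : M) =
  djoin (fun p : I * J => x p.1 + y p.2 : M) :> M.
Proof.
apply: (jle_anti djoinP); last first.
  by apply: join_lub => // p; apply: dle_add; exact: join_ub.
apply: dP_add_lub => _ [i _ <-]; rewrite addrC.
apply: dP_add_lub => _ [j _ <-]; rewrite addrC.
exact: (join_ub djoinP (fun p : I * J => x p.1 + y p.2 : M) (i, j)).
Qed.

Hypothesis S_semifield : semifield S.

Definition sigmaE_of_delta : sigmaE_algebra S.
Proof.
refine (@SigmaEAlgebra S D djoin _ _ _ djoinP (alg_semimodule (dS_algebra D))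
  _ dadd_join).
by move=> l I x /S_semifield[m [lm ml]]; exact: (@dscale_join l m).
Defined.

End DeltaToSigmaE.

(** * From equations to distributive laws *)

Section SigmaEToDelta.
Variable S : pzSemiRingType.
Variable E : sigmaE_algebra S.

Notation M := (smod (e_semimodule E)).
Notation ejoinP := (@ejoin_complete S E).
Notation ele := (jle (@ejoin S E)).
Notation esup := (join_set (@ejoin S E)).

Lemma ele_add (x y x' y' : M) :
  ele x x' -> ele y y' -> ele (x + y : M) (x' + y' : M).
Proof.
move=> <- <-; rewrite [X in ele _ X]eadd_join.
exact: (join_ub ejoinP (fun p : bool * bool =>
  eadd (if p.1 then x else x') (if p.2 then y else y')) (true, true)).
Qed.

Lemma ele_scale l (x y : M) : ele x y -> ele (l *: x : M) (l *: y : M).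
Proof.
(* The join axiom covers nonzero scalars only; at 0 both sides are zero. *)
move=> <-; have [->|l0] := pselect (l = 0).
  by rewrite !scale0r; exact: (jlexx ejoinP).
rewrite [X in ele _ X]escale_join //.
exact: (join_ub ejoinP (fun b : bool => escale l (if b then x else y)) true).
Qed.

Lemma eadd_scale_sup_lub (z c : M) l (A : set E) : l <> 0 ->
  (forall x : M, A x -> ele (z + l *: x : M) c) ->
  ele (z + l *: (esup A : M) : M) c.
Proof.
(* Seen as a join over [unit], [z] fits the distributivity of addition over joins. *)
move=> l0 ub; rewrite -(join_unit ejoinP z) /join_set.
rewrite [_ *: _]escale_join // [_ + _]eadd_join.
by apply: (join_lub ejoinP) => -[[] [x Ax]]; exact: ub.
Qed.

(** A list [t] of pairs lying over [s] encodes a choice of one element in each set. The induction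
    resolves one supremum at a time and moves the chosen term into the accumulator [z]. *)
Lemma esum_scale_sup_lub (w : set E -> S) (c : M) (s : seq {classic set E}) :
  (forall A, A \in s -> w A <> 0) -> forall z : M,
  (forall t : seq (ni E), map (@ni_set E) t = s ->
     ele (z + \sum_(p <- t) w (ni_set p) *: (ni_elt p : M) : M) c) ->
  ele (z + \sum_(A <- s) w A *: (esup A : M) : M) c.
Proof.
elim: s => [|A s IHs] w0 z ub; first by have := ub [::] erefl; rewrite !big_nil.
rewrite big_cons addrCA addrC; apply: eadd_scale_sup_lub => [|x Ax].
  exact/w0/mem_head.
rewrite addrAC; apply: IHs => [B Bs|t ts].
  by apply: w0; rewrite inE Bs orbT.
by have := ub (ni_pair Ax :: t); rewrite /= ts big_cons addrA; exact.
Qed.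

Lemma lincomb_esup (Phi : fsupp S (set E)) :
  lincomb (e_semimodule E) (fs_map esup Phi) =
  esup (lincomb (e_semimodule E) @` delta Phi).
Proof.
have [lZ lD] := lincomb_semilinear (e_semimodule E).
have lsum := semilinear_sum _ _ _ (lincomb_semilinear (e_semimodule E)).
apply: (jle_anti ejoinP); last first.
  apply: (join_set_lub ejoinP) => _ [_ /deltaP[psi <- <-] <-].
  have [s us sP] := finite_enum (fsvalP psi).
  rewrite (fs_decomp us sP) !(semilinear_sum _ _ _ (fs_map_semilinear S _)).
  rewrite !lsum.
  (* The two sums are compared term by term, using that the element of each pair lies below the
     supremum of its set. *)
  apply: (big_ind2 (fun x y : M => ele x y)) => [|x x' y y'|p _].
  - exact: (jlexx ejoinP).
  - exact: ele_add.
  - rewrite !(fs_map_semilinear S _).1 !lZ !fs_map_dirac !lincomb_dirac.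
    by apply: ele_scale; apply: (join_set_ub ejoinP); exact: (proj2_sig p).
(* The enumeration has to be exactly the support, since [esum_scale_sup_lub] requires nonzero
   coefficients. *)
have [s us sP] : exists2 s : seq {classic set E}, uniq s &
    forall A, A \in s <-> Phi A <> 0.
  have [s us sP] := finite_enum (fsvalP Phi).
  exists [seq A : {classic set E} <- s | `[< Phi A <> 0 >]].
    exact: filter_uniq.
  move=> A; rewrite mem_filter; split=> [/andP[/asboolP]//|PhiA].
  by rewrite asboolT //= sP.
have PhiE := fs_decomp us (fun A => (sP A).2).
rewrite [in fs_map _ _]PhiE (semilinear_sum _ _ _ (fs_map_semilinear S _)) lsum.
rewrite -[X in ele X _]add0r.
under eq_bigr do
  rewrite (fs_map_semilinear S _).1 lZ fs_map_dirac lincomb_dirac.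
apply: esum_scale_sup_lub => [A /sP//|t ts]; rewrite add0r.
apply: (join_set_ub ejoinP).
(* The coupling attached to the choice [t] puts the mass [Phi A] on the pair chosen over [A]. *)
exists (fs_map (@ni_elt E)
    (\sum_(p <- t) Phi (ni_set p) *: fs_dirac S p)); last first.
  rewrite (semilinear_sum _ _ _ (fs_map_semilinear S _)) lsum.
  apply: eq_bigr => p _.
  by rewrite (fs_map_semilinear S _).1 lZ fs_map_dirac lincomb_dirac.
apply/deltaP; eexists; last by [].
rewrite (semilinear_sum _ _ _ (fs_map_semilinear S _)) [RHS]PhiE -ts big_map.
by apply: eq_bigr => p _; rewrite (fs_map_semilinear S _).1 fs_map_dirac.
Qed.

Definition delta_of_sigmaE : delta_algebra S :=
  @DeltaAlgebra S E (lincomb (e_semimodule E)) esup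
    (lincomb_algebra (e_semimodule E)) (join_set_algebra ejoinP) lincomb_esup.

End SigmaEToDelta.

(** * The isomorphism *)

(* Objects of [D] may be equal without being convertible, so arrows are
   compared through their underlying functions, by heterogeneous equality. *)
Lemma functor_eq (C D : category) (U : D -> Type)
    (u : forall X Y : D, hom X Y -> U X -> U Y) (F G : functor C D) :
  (forall X Y, injective (@u X Y)) -> (forall X, F X = G X) ->
  (forall X Y (f : hom X Y), JMeq (u _ _ (farr F f)) (u _ _ (farr G f))) ->
  F = G.
Proof.
case: F G => [Fo Fa F1 Fc] [Go Ga G1 Gc] /= u_inj FG; move: F1 Fc G1 Gc.
(* Once the object maps are identified, the arrows have the same type and [JMeq] becomes
   equality. *)
have {FG} FG : Fo = Go by apply: funext.
case: Go / FG Ga => Ga F1 Fc G1 Gc uFG.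
have FG : Fa = Ga.
  apply: functional_extensionality_dep => X.
  apply: functional_extensionality_dep => Y.
  by apply: funext => f; apply: u_inj; apply: JMeq_eq; exact: uFG.
by case: Ga / FG G1 Gc {uFG} => G1 Gc; congr Functor; exact: Prop_irrelevance.
Qed.

Lemma delta_algebra_eq (S : pzSemiRingType) X a b aP bP ab a' b' aP' bP' ab' :
  a = a' -> b = b' ->
  @DeltaAlgebra S X a b aP bP ab = @DeltaAlgebra S X a' b' aP' bP' ab'.
Proof.
move=> aa' bb'; case: a' / aa' aP' ab' => aP' ab'; case: b' / bb' bP' ab' => *.
by congr DeltaAlgebra; exact: Prop_irrelevance.
Qed.

Lemma sigmaE_algebra_eq (S : pzSemiRingType) X join add zero scale
    joinP H scale_join add_join join' add' zero' scale' joinP' H' scale_join'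
    add_join' :
  (forall I x, join I x = join' I x) -> (forall x y, add x y = add' x y) ->
  zero = zero' -> (forall l x, scale l x = scale' l x) ->
  @SigmaEAlgebra S X join add zero scale joinP H scale_join add_join =
  @SigmaEAlgebra S X join' add' zero' scale' joinP' H' scale_join' add_join'.
Proof.
move=> joinE addE zeroE scaleE.
have {}joinE : join = join'.
  by apply: functional_extensionality_dep => I; apply: funext.
have {}addE : add = add' by apply: funext => x; apply: funext.
have {}scaleE : scale = scale' by apply: funext => l; apply: funext.
subst; congr SigmaEAlgebra; exact: Prop_irrelevance.
Qed.

Section Isomorphism.
Variable S : pzSemiRingType.
Hypothesis S_positive : positive_semiring S.
Hypothesis S_semifield : semifield S.

Notation sigmaE_of D := (sigmaE_of_delta D S_positive S_semifield).

Lemma sigmaE_of_delta_morphism (X Y : delta_algebra S) (f : X -> Y) :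
  is_delta_morphism f -> @is_sigmaE_morphism S (sigmaE_of X) (sigmaE_of Y) f.
Proof.
move=> [fS fP]; have [mZ mD] := fs_map_semilinear S f; split.
- move=> I x; rewrite [LHS]fP; congr (@dP S Y).
  by rewrite /= image_comp.
- by move=> x y; rewrite [LHS]fS /= mD !fs_map_dirac.
- by rewrite [LHS]fS /= -(scale0r 0) mZ scale0r.
- by move=> l x; rewrite [LHS]fS /= mZ fs_map_dirac.
Qed.

Lemma delta_of_sigmaE_morphism (X Y : sigmaE_algebra S) (f : X -> Y) :
  is_sigmaE_morphism f ->
  @is_delta_morphism S (delta_of_sigmaE X) (delta_of_sigmaE Y) f.
Proof.
move=> [fJ fD _ fZ]; split=> [phi|A]; first exact: lincomb_morph.
(* The joins are indexed by [A] and by its image, so only the ranges of the two families can be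
   compared. *)
rewrite /= /join_set fJ; apply: (join_eq (@ejoin_complete S Y)).
  by move=> [x Ax]; exists (exist _ (f x) (imageP f Ax)).
by move=> [y yA]; have [x Ax e] := yA; exists (exist _ x Ax).
Qed.

Definition sigmaE_functor : functor (delta_category S) (sigmaE_category S).
Proof.
refine (@Functor (delta_category S) (sigmaE_category S)
  (fun D : delta_algebra S => sigmaE_of D)
  (fun X Y (f : delta_hom X Y) =>
    exist _ (sval f) (sigmaE_of_delta_morphism (proj2_sig f))) _ _) => *;
  exact: sigmaE_hom_eq.
Defined.

Definition delta_functor : functor (sigmaE_category S) (delta_category S).
Proof.
refine (@Functor (sigmaE_category S) (delta_category S)
  (fun E : sigmaE_algebra S => delta_of_sigmaE E)
  (fun X Y (f : sigmaE_hom X Y) =>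
    exist _ (sval f) (delta_of_sigmaE_morphism (proj2_sig f))) _ _) => *;
  exact: delta_hom_eq.
Defined.

(** The original [dS] is semilinear and sends each Dirac function to its point, which characterizes
    [lincomb]. *)
Lemma delta_of_sigmaE_of_delta (D : delta_algebra S) :
  delta_of_sigmaE (sigmaE_of D) = D.
Proof.
case: D => X a b aP bP ab; apply: delta_algebra_eq; last exact: alg_join_set.
apply: funext => phi; apply/esym/(lincomb_uniq (H := alg_semimodule aP)).
  by split=> *; [exact: alg_scaleE|exact: alg_addE].
exact: alg_dirac.
Qed.

Lemma sigmaE_of_delta_of_sigmaE (E : sigmaE_algebra S) :
  sigmaE_of (delta_of_sigmaE E) = E.
Proof.
have E1 := lincomb_dirac (e_semimodule E).
have [lZ lD] := lincomb_semilinear (e_semimodule E).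
case: E E1 lZ lD => X join add zero scale joinP H sj aj /= E1 lZ lD.
apply: sigmaE_algebra_eq => [I x|x y||l x].
- exact: join_set_range.
- by rewrite /alg_add /= lD !E1.
- by rewrite /alg_zero /= -(scale0r 0) lZ scale0r.
- by rewrite /alg_scale /= lZ E1.
Qed.

End Isomorphism.

Theorem theorem5p11 (S : pzSemiRingType) (S_positive : positive_semiring S)
    (S_semifield : semifield S) :
  isomorphic_categories (delta_category S) (sigmaE_category S).
Proof.
exists (sigmaE_functor S_positive S_semifield), (delta_functor S); split.
  (* Both functors leave carriers and underlying functions unchanged, so the arrows agree by
     conversion although their end objects are only provably equal. *)
  apply: (@functor_eq _ (delta_category S) (@dcar S)
    (fun X Y (f : delta_hom X Y) => sval f)) => [X Y f g|X|X Y f].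
  - exact: delta_hom_eq.
  - exact: delta_of_sigmaE_of_delta.
  - exact: JMeq_refl.
apply: (@functor_eq _ (sigmaE_category S) (@ecar S)
  (fun X Y (f : sigmaE_hom X Y) => sval f)) => [X Y f g|X|X Y f].
- exact: sigmaE_hom_eq.
- exact: sigmaE_of_delta_of_sigmaE.
- exact: JMeq_refl.
Qed.
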